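(* Let $\beta\ge 1$ be an integer and let $M=M^*\in\mathbb{C}^{n\times n}$ be $\beta$-banded and positive definite with smallest eigenvalue $\lambda_{\min}$. Let $\widehat M=M-\lambda_{\min}I$ and let $\rho>0$ be such that the spectrum of $\widehat M$ is contained in $[0,4\rho]$. Let $f$ be a Laplace--Stieltjes function, written as $f(x)=\int_0^\infty \mathrm{e}^{-x\tau}\,\mathrm{d}\alpha(\tau)$ for $x>0$. Then for all indices $k,t$ with $|k-t|/\beta\ge 2$, $$|(f(M))_{kt}|\le\int_0^\infty \exp(-\lambda_{\min}\tau)\,|(\exp(-\tau\widehat M))_{kt}|\,\mathrm{d}\alpha(\tau)\le I+II+III,$$ where $$I=10\int_0^{\frac{|k-t|}{2\rho\beta}}\exp(-\lambda_{\min}\tau)\,\frac{\exp(-\rho\tau)}{\rho\tau}\left(\frac{\mathrm{e}\,\rho\tau}{|k-t|/\beta}\right)^{|k-t|/\beta}\mathrm{d}\alpha(\tau),$$ $$II=10\int_{\frac{|k-t|}{2\rho\beta}}^{\frac{|k-t|^2}{4\rho\beta^2}}\exp(-\lambda_{\min}\tau)\exp\left(-\frac{(|k-t|/\beta)^2}{5\rho\tau}\right)\mathrm{d}\alpha(\tau),$$ $$III=\int_{\frac{|k-t|^2}{4\rho\beta^2}}^{\infty}\exp(-\lambda_{\min}\tau)\,|(\exp(-\tau\widehat M))_{kt}|\,\mathrm{d}\alpha(\tau).$$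
   Context: A matrix $M\in\mathbb{C}^{n\times n}$ is $\beta$-banded if $M_{ij}=0$ whenever $|i-j|>\beta$. A Laplace--Stieltjes function is a function $f$ that is strictly completely monotonic on $(0,\infty)$, i.e. $(-1)^k f^{(k)}(x)>0$ for all $x>0$ and all $k=0,1,2,\dots$. By Bernstein's theorem such an $f$ can be written as $f(x)=\int_0^\infty \mathrm{e}^{-\tau x}\,\mathrm{d}\alpha(\tau)$ with $\alpha$ nondecreasing on $[0,\infty)$ and the (Stieltjes) integral convergent for all $x>0$; $\alpha$ denotes such a function. All integrals are taken with respect to the positive measure $\mathrm{d}\alpha$ on $[0,\infty)$ over intervals including their finite endpoints, and the integrand of $I$ at $\tau=0$ is understood as its limit $0$. $f(M)$ is defined by the usual functional calculus for Hermitian matrices. *)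

(* Defs.v *)
From HB Require Import structures.
From mathcomp Require Import all_boot all_order all_algebra.
From mathcomp Require Import complex lra.
From mathcomp Require Import all_classical all_reals all_analysis.
Import Order.TTheory GRing.Theory Num.Theory.
Import numFieldNormedType.Exports.

Set Implicit Arguments.
Unset Strict Implicit.
Unset Printing Implicit Defensive.

Local Open Scope classical_set_scope.
Local Open Scope ring_scope.
Local Open Scope complex_scope.
Local Open Scope sesquilinear_scope.

Section Matrices.
Variables (R : realType) (n : nat).

Definition banded (beta : nat) (M : 'M[R[i]]_n) : Prop :=
  forall i j : 'I_n, beta%:R < `|i%:R - j%:R| :> R -> M i j = 0.

(* The order of [R[i]] relates only numbers with equal imaginary parts, so
   [0 < z] says that [z] is real and positive. *)
Definition posdef (M : 'M[R[i]]_n) : Prop :=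
  forall v : 'cV[R[i]]_n, v != 0 -> 0 < (v ^t* *m M *m v) 0 0.

(* [mathcomp]'s [eigenvalue] is about left (row) eigenvectors; the eigenvalues
   are the same as for column vectors. *)
Definition smallest_eigenvalue (M : 'M[R[i]]_n) (l : R) : Prop :=
  eigenvalue M l%:C /\ forall z : R[i], eigenvalue M z -> l%:C <= z.

Definition spectrum_in (M : 'M[R[i]]_n) (a b : R) : Prop :=
  forall z : R[i], eigenvalue M z -> a%:C <= z <= b%:C.

(* f(M) = P^* diag(f(l_1), ..., f(l_n)) P, where M = P^* diag(l_1, ..., l_n) P
   with P unitary is the spectral decomposition of the Hermitian matrix M. The
   l_i are real, so that taking [Re] loses nothing. *)
Definition herm_fun (f : R -> R) (M : 'M[R[i]]_n) : 'M[R[i]]_n :=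
  invmx (spectralmx M)
    *m diag_mx (map_mx (fun z => (f (complex.Re z))%:C) (spectral_diag M))
    *m spectralmx M.

End Matrices.

Section LaplaceStieltjes.
Variable R : realType.

Definition strictly_completely_monotonic (f : R -> R) : Prop :=
  forall (k : nat) (x : R), 0 < x ->
    derivable (derive1n k f) x 1 /\ 0 < (-1) ^+ k * derive1n k f x.

Definition nondecreasing_on_pos (alpha : R -> R) : Prop :=
  {in `[0, +oo[ &, {homo alpha : s t / s <= t}}.

(* [alpha] need not be right-continuous. The measure d(alpha) is the
   Lebesgue-Stieltjes measure of t |-> alpha(t+), extended by the constant
   alpha(0) to t < 0. It gives mass alpha(0+) - alpha(0) to {0}, mass
   alpha(t+) - alpha(t-) to {t} for t > 0, and no mass to ]-oo, 0[. *)
Definition right_limit_ext (alpha : R -> R) (t : R) : R :=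
  if t < 0 then alpha 0 else inf [set alpha s | s in [set s | t < s]].

Lemma right_limit_ext_le (alpha : R -> R) (t s : R) :
  nondecreasing_on_pos alpha -> 0 <= t -> t < s ->
  right_limit_ext alpha t <= alpha s.
Proof.
move=> nd t0 ts; rewrite /right_limit_ext ltNge t0 /=.
apply: ge_inf; last by exists s.
exists (alpha t) => _ [u /= tu <-].
by apply: nd; rewrite ?in_itv/= ?andbT ?t0 //; [exact: le_trans (ltW tu)|exact: ltW].
Qed.

Lemma le_right_limit_ext (alpha : R -> R) (t c : R) : 0 <= t ->
  (forall s, t < s -> c <= alpha s) -> c <= right_limit_ext alpha t.
Proof.
move=> t0 H; rewrite /right_limit_ext ltNge t0 /=; apply: lb_le_inf.
  by exists (alpha (t + 1)), (t + 1) => //=; rewrite ltrDl.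
by move=> _ [s /= ts <-]; exact: H.
Qed.

Lemma right_limit_ext_nondecreasing (alpha : R -> R) :
  nondecreasing_on_pos alpha -> nondecreasing (right_limit_ext alpha).
Proof.
move=> nd x y xy; have [y0|y0] := ltP y 0.
  by rewrite /right_limit_ext y0 (le_lt_trans xy y0).
apply: le_right_limit_ext => // s ys; have [x0|x0] := ltP x 0; last first.
  by apply: right_limit_ext_le => //; exact: le_lt_trans ys.
rewrite /right_limit_ext x0; apply: nd.
- by rewrite in_itv/= lexx.
- by rewrite in_itv/= andbT (le_trans y0 (ltW ys)).
- exact: le_trans y0 (ltW ys).
Qed.

Lemma right_limit_ext_right_continuous (alpha : R -> R) :
  nondecreasing_on_pos alpha -> right_continuous (right_limit_ext alpha).
Proof.
move=> nd x; apply/cvgrPdist_lt => e e0.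
have mono := right_limit_ext_nondecreasing nd.
suff [s xs As] : exists2 s, x < s & right_limit_ext alpha s < right_limit_ext alpha x + e.
  near=> y.
  have xy : x < y by near: y; exact: nbhs_right_gt.
  have ys : y <= s by near: y; apply: nbhs_right_le.
  rewrite distrC ger0_norm ?subr_ge0 ?mono ?ltW//.
  by rewrite ltrBlDl (le_lt_trans (mono _ _ ys)).
have [x0|x0] := ltP x 0.
  exists (x / 2); first by lra.
  have x20 : x / 2 < 0 by lra.
  by rewrite /right_limit_ext x0 x20 ltrDl.
have [u xu Au] : exists2 u, x < u & alpha u < right_limit_ext alpha x + e.
  apply: contrapT => H.
  suff : right_limit_ext alpha x + e <= right_limit_ext alpha x.
    by rewrite leNgt ltrDl e0.
  apply: le_right_limit_ext => // s xs; rewrite leNgt; apply/negP => ?.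
  by apply: H; exists s.
exists ((x + u) / 2); first by rewrite midf_lt.
apply: le_lt_trans Au; apply: right_limit_ext_le => //; last by rewrite midf_lt.
by lra.
Unshelve. all: by end_near. Qed.

Definition stieltjes_cumulative (alpha : R -> R)
    (nd : nondecreasing_on_pos alpha) : cumulative R R :=
  HB.pack (right_limit_ext alpha)
    (isCumulative.Build R _ R (right_limit_ext alpha)
      (right_limit_ext_nondecreasing nd)
      (right_limit_ext_right_continuous nd)).

Definition stieltjes_measure (alpha : R -> R)
    (nd : nondecreasing_on_pos alpha) :=
  lebesgue_stieltjes_measure (stieltjes_cumulative nd).

(* The equation in extended reals includes the convergence of the integral. *)
Definition laplace_stieltjes (f alpha : R -> R)
    (nd : nondecreasing_on_pos alpha) : Prop :=
  forall x : R, 0 < x ->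
    (\int[stieltjes_measure nd]_(tau in `[0%R, +oo[) (expR (- x * tau))%:E
       = (f x)%:E)%E.

End LaplaceStieltjes.

(* Main.v *)
Require Import Defs.
From HB Require Import structures.
From mathcomp Require Import all_boot all_order all_algebra.
From mathcomp Require Import complex ring lra.
From mathcomp Require Import all_classical all_reals all_analysis.
From mathcomp Require Import measurable_realfun.
Import Order.TTheory GRing.Theory Num.Theory.
Import numFieldNormedType.Exports.

Local Open Scope classical_set_scope.
Local Open Scope ring_scope.
Local Open Scope complex_scope.

(* Let m_1, ..., m_n be the eigenvalues of M and w = rho tau. By the spectral
   theorem f(M)_kt = sum_l c_l f(m_l), where sum_l |c_l| <= 1, and after rotating
   the c_l by the phase of the sum they may be taken real, say a_l. Integrating
   f(m_l) = int exp(-m_l tau) dalpha(tau) against the a_l gives the first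
   inequality. For the second one, put s = 1 - (m - lmin) / (2 rho), which lies in
   [-1, 1], and d = |k - t| / beta. The matrix with eigenvalues s_l is beta-banded,
   so the functional L g = sum_l a_l g(s_l) kills all polynomials of degree < d,
   while |L T_m| <= 1 for every Chebyshev polynomial T_m. Since s T_m is the
   average of T_(m+1) and T_(m-1), |L s^N| <= 2 exp(-th d) (cosh th)^N for all
   th >= 0. Summing the exponential series,
     |exp(-tau (M - lmin))_kt| <= 2 exp(2 w (cosh th - 1) - th d).
   The choice th = d / (2 w) gives the Gaussian bound of II, and th = ln(d / w)
   the bound of I. *)

Set Implicit Arguments.
Unset Strict Implicit.

(** * Elementary bounds on the exponential and the hyperbolic cosine *)

(** The function [g] below has [g 0 = 2] and derivative 1 - (1 + x) exp(-x) >= 0 for x >= 0, so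
    [g u >= 2], which is the claim with denominators cleared. *)
Lemma expR_le_pade (R : realType) (u : R) : 0 <= u < 2 ->
  expR u <= (2 + u) / (2 - u).
Proof.
move=> /andP[u0 u2].
rewrite ler_pdivlMr ?subr_gt0// mulrC.
pose g (x : R) := expR (- x) * (2 + x) + x.
have dg (x : R) : is_derive x 1 g (1 - (1 + x) * expR (- x)).
  by apply: is_derive_eq; rewrite /GRing.scale/=; ring.
have cg (x : R) : {for x, continuous g}.
  by apply: differentiable_continuous; apply/derivable1_diffP; exact: ex_derive.
have : g 0 <= g u.
  apply: (@ger0_derive1_le_cc _ g 0 u); rewrite ?in_itv/= ?lexx ?u0//.
  - move=> x _; rewrite derive1E derive_val expRN subr_ge0.
    by rewrite ler_pdivrMr ?expR_gt0// mul1r expR_ge1Dx.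
  - by apply: continuous_subspaceT => x; exact: cg.
rewrite /g oppr0 expR0 addr0 mul1r expRN => h.
have : 2 - u <= (expR u)^-1 * (2 + u) by lra.
by rewrite ler_pdivlMl ?expR_gt0// mulrC.
Qed.

(** With y = x / 2, cosh x = 1 + 2 (sinh y)^2, and the previous bound gives 2 sinh y <= 8 y / (4 -
    y^2) <= (32/15) y for y <= 1/2. The resulting constant (32/15)^2 / 8 is below 3/5, the value
    that produces the 5 in the exponent of II. *)
Lemma cosh_le_quadratic (R : realType) (x : R) : 0 <= x <= 1 ->
  (expR x + expR (- x)) / 2 <= 1 + 3 / 5 * x ^+ 2.
Proof.
move=> /andP[x0 x1].
have [y xE] : exists y, x = y * 2%:R by exists (x / 2); field.
have [y0 y1] : 0 <= y /\ y <= 1 / 2 by split; lra.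
have y12 : 0 < 4 - y ^+ 2 by nra.
have e0 := expR_gt0 y.
have e1 : 1 <= expR y by rewrite -[X in X <= _]expR0 ler_expR.
have eq : expR y <= (2 + y) / (2 - y) by apply: expR_le_pade; apply/andP; split; lra.
have iq : (2 - y) / (2 + y) <= (expR y)^-1.
  by rewrite -[X in X <= _]invrK lef_pV2 ?posrE ?invf_div ?divr_gt0//; lra.
have d : expR y - (expR y)^-1 <= 8 * y / (4 - y ^+ 2).
  have -> : 8 * y / (4 - y ^+ 2) = (2 + y) / (2 - y) - (2 - y) / (2 + y).
    by field; rewrite !gt_eqF//; lra.
  lra.
have d' : 8 * y / (4 - y ^+ 2) <= 32 / 15 * y.
  by rewrite ler_pdivrMr//; nra.
have d0 : 0 <= expR y - (expR y)^-1 by rewrite subr_ge0 (le_trans _ e1)// invf_le1.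
rewrite xE -mulNr !expRM_natr expRN.
have -> : (expR y ^+ 2 + (expR y)^-1 ^+ 2) / 2 = 1 + (expR y - (expR y)^-1) ^+ 2 / 2.
  by field; rewrite gt_eqF.
have : (expR y - (expR y)^-1) ^+ 2 <= (32 / 15 * y) ^+ 2.
  by rewrite lerXn2r ?nnegrE//; lra.
nra.
Qed.

(** * Chebyshev moments and scalar decay estimates *)

(* [cos (m%:R * acos s)] is the Chebyshev polynomial [T_m] at [s]. *)
Lemma chebyshev_moment_le (R : realType) (n : nat) (a s : 'I_n -> R) (d th : R) :
  0 <= th -> \sum_l `|a l| <= 1 -> (forall l, -1 <= s l <= 1) ->
  (forall j : nat, j%:R < d -> \sum_l a l * s l ^+ j = 0) ->
  forall N m : nat,
    `|\sum_l a l * (s l ^+ N * cos (m%:R * acos (s l)))| <=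
      expR (- (th * d)) * ((expR th + expR (- th)) / 2) ^+ N
        * (expR (th * m%:R) + expR (- (th * m%:R))).
Proof.
move=> th0 a1 s1 as0.
have sK l : cos (acos (s l)) = s l by rewrite acosK// in_itv/= s1.
have cosS m l : cos (m.+2%:R * acos (s l)) =
    2 * s l * cos (m.+1%:R * acos (s l)) - cos (m%:R * acos (s l)).
  have -> : m.+2%:R * acos (s l) = m.+1%:R * acos (s l) + acos (s l).
    by rewrite -[m.+2]addn1 natrD mulrDl mul1r.
  have -> : m%:R * acos (s l) = m.+1%:R * acos (s l) - acos (s l).
    by rewrite -[m.+1]addn1 natrD mulrDl mul1r addrK.
  by rewrite cosB cosD sK; ring.
have cos1 l : cos (1%:R * acos (s l)) = s l by rewrite mul1r sK.
(* The polynomial s^j T_m has degree j + m, so the functional annihilates it when j + m < d. *)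
have T0 m j : (j + m)%:R < d -> \sum_l a l * (s l ^+ j * cos (m%:R * acos (s l))) = 0.
  elim/ltn_ind: m j => -[|[|m]] IH j jm.
  - rewrite addn0 in jm; rewrite -[RHS](as0 j jm).
    by apply: eq_bigr => l _; rewrite mul0r cos0 mulr1.
  - rewrite addn1 in jm; rewrite -[RHS](as0 _ jm).
    by apply: eq_bigr => l _; rewrite cos1 exprSr.
  - rewrite (eq_bigr (fun l => 2 * (a l * (s l ^+ j.+1 * cos (m.+1%:R * acos (s l))))
        - a l * (s l ^+ j * cos (m%:R * acos (s l))))); last first.
      by move=> l _; rewrite cosS exprS; ring.
    rewrite sumrB -mulr_sumr !IH ?mulr0 ?subr0//.
      by apply: le_lt_trans jm; rewrite ler_nat leq_add2l -addn2 leq_addr.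
    by rewrite addSnnS.
(* Induction on [N] for all [m] at once, since multiplication by s sends T_m to its neighbours. For
   [N = 0] the sum vanishes if m < d; otherwise it is at most 1 <= exp(th (m - d)). *)
elim=> [|N IH] m.
  rewrite expr0 mulr1; have [md|md] := ltP m%:R d.
    rewrite (T0 m 0%N)// normr0.
    by rewrite mulr_ge0 ?addr_ge0 ?expR_ge0.
  apply: le_trans (_ : 1 <= _).
    apply: le_trans a1; apply: le_trans (ler_norm_sum _ _ _) _.
    apply: ler_sum => l _; rewrite expr0 mul1r normrM ler_piMr//.
    by rewrite ler_norml cos_geN1 cos_le1.
  rewrite mulrDr -expRD -[X in X <= _]addr0 lerD ?mulr_ge0 ?expR_ge0//.
  by rewrite -[X in X <= _]expR0 ler_expR addrC -mulrN -mulrDr mulr_ge0// subr_ge0.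
have e2 (x : R) : expR (th * (x + 1)) = expR (th * x) * expR th.
  by rewrite -expRD; congr expR; ring.
(* T_0 has no lower neighbour: here s T_0 = T_1 replaces the average. *)
case: m => [|m].
  rewrite (eq_bigr (fun l => a l * (s l ^+ N * cos (1%:R * acos (s l))))); last first.
    by move=> l _; rewrite cos1 mul0r cos0 mulr1 exprSr.
  apply: le_trans (IH 1%N) _; rewrite !mulr1 !mulr0 oppr0 expR0 exprSr.
  by rewrite le_eqVlt; apply/orP; left; apply/eqP; field.
rewrite (eq_bigr (fun l => 2^-1 * (a l * (s l ^+ N * cos (m.+2%:R * acos (s l)))
    + a l * (s l ^+ N * cos (m%:R * acos (s l)))))); last first.
  by move=> l _; rewrite cosS exprSr; field.
rewrite -mulr_sumr big_split/= normrM ger0_norm ?invr_ge0//.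
have := lerD (IH m.+2) (IH m) => /(le_trans (ler_normD _ _)) h.
rewrite mulrC ler_pdivrMr//; apply: le_trans h _.
set A := expR (- (th * d)); set c := (expR th + _) / 2; set D := expR (th * m.+1%:R) + _.
have -> : A * c ^+ N.+1 * D * 2 = A * c ^+ N * (c * D * 2) by rewrite exprSr; ring.
rewrite -mulrDr; apply: ler_wpM2l.
  by rewrite mulr_ge0 ?expR_ge0// exprn_ge0// divr_ge0// addr_ge0 ?expR_ge0.
(* The bound satisfies the same averaging rule, with equality: 2 cosh(th) cosh(th (m + 1)) = cosh(th
   (m + 2)) + cosh(th m). *)
rewrite /D /c.
have t1 : th * m.+1%:R = th * m%:R + th by rewrite -[m.+1]addn1 natrD; ring.
have t2 : th * m.+2%:R = th * m%:R + th + th by rewrite -[m.+2]addn2 natrD; ring.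
rewrite t1 t2 !opprD !expRD !expRN.
rewrite le_eqVlt; apply/orP; left; apply/eqP; field.
by rewrite !gt_eqF ?expR_gt0.
Qed.

(** Each s^N in the exponential series is bounded by the case m = 0 of the previous lemma, the
    factor 2 being [expR 0 + expR 0]. As z >= 0, these bounds sum to a multiple of exp(z cosh
    th). *)
Lemma exp_moment_le (R : realType) (n : nat) (a s : 'I_n -> R) (d th z : R) :
  0 <= th -> 0 <= z -> \sum_l `|a l| <= 1 -> (forall l, -1 <= s l <= 1) ->
  (forall j : nat, j%:R < d -> \sum_l a l * s l ^+ j = 0) ->
  \sum_l a l * expR (z * s l) <=
    2 * expR (- (th * d) + z * ((expR th + expR (- th)) / 2)).
Proof.
move=> th0 z0 a1 s1 as0.
set c := (_ + _) / 2; have c0 : 0 <= c by rewrite divr_ge0// addr_ge0 ?expR_ge0.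
have cvgl : (fun K => \sum_l a l * series (exp_coeff (z * s l)) K) @ \oo -->
    \sum_l a l * expR (z * s l).
  apply: cvg_big => //; first exact: add_continuous.
  by move=> l _; apply: cvgMr; exact: is_cvg_series_exp_coeff.
have cvgr : (fun K => 2 * expR (- (th * d)) * series (exp_coeff (z * c)) K) @ \oo -->
    2 * expR (- (th * d)) * expR (z * c).
  by apply: cvgMr; exact: is_cvg_series_exp_coeff.
rewrite expRD mulrA; apply: ler_cvg_to cvgl cvgr _; apply: nearW => K.
rewrite /series/= [in X in _ <= X]big_mkord.
under eq_bigr do rewrite big_mkord mulr_sumr.
rewrite exchange_big/= mulr_sumr; apply: ler_sum => N _; rewrite /exp_coeff/=.
rewrite (eq_bigr (fun l => z ^+ N / N`!%:R * (a l * (s l ^+ N * cos (0%:R * acos (s l)))))).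
  have -> : 2 * expR (- (th * d)) * ((z * c) ^+ N / N`!%:R) =
      z ^+ N / N`!%:R * (expR (- (th * d)) * c ^+ N * 2) by rewrite exprMn; ring.
  rewrite -mulr_sumr; apply: ler_wpM2l; first by rewrite divr_ge0// exprn_ge0.
  apply: le_trans (ler_norm _) _.
  apply: le_trans (@chebyshev_moment_le _ _ _ _ _ _ th0 a1 s1 as0 N 0) _.
  by rewrite mulr0 oppr0 expR0 -/c le_eqVlt; apply/orP; left; apply/eqP; ring.
by move=> l _; rewrite mul0r cos0 exprMn; ring.
Qed.
(** Put s = 1 - x / (2 rho), which lies in [-1, 1]; then exp(-tau x) = exp(-2 rho tau) exp(2 rho tau
    s). *)
Lemma exp_decay_le (R : realType) (n : nat) (a x : 'I_n -> R) (rho tau d th : R) :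
  0 < rho -> 0 <= tau -> 0 <= th ->
  \sum_l `|a l| <= 1 -> (forall l, 0 <= x l <= 4 * rho) ->
  (forall j : nat, j%:R < d -> \sum_l a l * (1 - x l / (2 * rho)) ^+ j = 0) ->
  \sum_l a l * expR (- tau * x l) <=
    2 * expR (2 * (rho * tau) * ((expR th + expR (- th)) / 2 - 1) - th * d).
Proof.
move=> rho0 tau0 th0 a1 x4 a0.
have s1 l : -1 <= 1 - x l / (2 * rho) <= 1.
  have /andP[x0 xr] := x4 l.
  have : x l / (2 * rho) <= 2 by rewrite ler_pdivrMr ?mulr_gt0//; lra.
  have : 0 <= x l / (2 * rho) by rewrite divr_ge0// mulr_ge0// ltW.
  by move=> ? ?; apply/andP; split; lra.
have z0 : 0 <= 2 * rho * tau by rewrite !mulr_ge0// ltW.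
have -> : \sum_l a l * expR (- tau * x l) = expR (- (2 * rho * tau)) *
    \sum_l a l * expR (2 * rho * tau * (1 - x l / (2 * rho))).
  rewrite mulr_sumr; apply: eq_bigr => l _.
  rewrite mulrCA -expRD; congr (_ * expR _); field.
  by rewrite gt_eqF.
apply: le_trans (ler_wpM2l (expR_ge0 _) (exp_moment_le th0 z0 a1 s1 a0)) _.
rewrite mulrCA -expRD ler_pM2l// ler_expR.
by rewrite le_eqVlt; apply/orP; left; apply/eqP; field.
Qed.

(** With w = rho tau, the condition d <= 2 w puts th = d / (2 w) in [0, 1], where the quadratic
    bound on cosh applies; the exponent is then at most 2 w (3/5) th^2 - th d = -d^2 / (5 w). *)
Lemma exp_decay_gaussian (R : realType) (n : nat) (a x : 'I_n -> R) (rho tau d : R) :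
  0 < rho -> 0 < d -> d <= 2 * (rho * tau) ->
  \sum_l `|a l| <= 1 -> (forall l, 0 <= x l <= 4 * rho) ->
  (forall j : nat, j%:R < d -> \sum_l a l * (1 - x l / (2 * rho)) ^+ j = 0) ->
  \sum_l a l * expR (- tau * x l) <= 10 * expR (- (d ^+ 2 / (5 * rho * tau))).
Proof.
move=> rho0 d0 dw a1 x4 a0.
have w0 : 0 < rho * tau by lra.
have tau0 : 0 < tau by move: w0; rewrite pmulr_rgt0.
have rn : rho != 0 by rewrite gt_eqF.
have tn : tau != 0 by rewrite gt_eqF.
have th01 : 0 <= d / (2 * (rho * tau)) <= 1.
  apply/andP; split; first by rewrite divr_ge0//; lra.
  by rewrite ler_pdivrMr ?mul1r//; lra.
have /andP[th0 _] := th01.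
apply: le_trans (exp_decay_le rho0 (ltW tau0) th0 a1 x4 a0) _.
apply: (@le_trans _ _ (2 * expR (- (d ^+ 2 / (5 * rho * tau))))).
  rewrite ler_pM2l// ler_expR.
  have h := cosh_le_quadratic th01.
  apply: le_trans (_ : 2 * (rho * tau) * (3 / 5 * (d / (2 * (rho * tau))) ^+ 2)
     - d / (2 * (rho * tau)) * d <= _).
    by rewrite lerD2r; apply: ler_wpM2l; [lra|lra].
  by rewrite le_eqVlt; apply/orP; left; apply/eqP; field; rewrite rn tn.
by rewrite ler_wpM2r ?expR_ge0//; lra.
Qed.

(** For w = rho tau and th = ln(d / w) the exponent splits into w^2 / d - w and -w + d (1 - ln(d /
    w)). The second part exponentiates to exp(-w) (e w / d)^d; the first is at most -w / 2 because 2
    w <= d, and this decay yields the factor 10 / w. *)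
Lemma exp_decay_poisson (R : realType) (n : nat) (a x : 'I_n -> R) (rho tau d : R) :
  0 < rho -> 0 < d -> 0 <= tau -> 2 * (rho * tau) <= d ->
  \sum_l `|a l| <= 1 -> (forall l, 0 <= x l <= 4 * rho) ->
  (forall j : nat, j%:R < d -> \sum_l a l * (1 - x l / (2 * rho)) ^+ j = 0) ->
  \sum_l a l * expR (- tau * x l) <=
    10 * (expR (- rho * tau) / (rho * tau) * (expR 1 * rho * tau / d) `^ d).
Proof.
move=> rho0 d0; rewrite le_eqVlt => /predU1P[<- _ _ _ a0|tau0 wd a1 x4 a0].
  (* At tau = 0 the right side is 0, as [0^-1 = 0]; the left side is the moment of order 0, which
     vanishes since 0 < d. *)
  rewrite (eq_bigr (fun l => a l * (1 - x l / (2 * rho)) ^+ 0)).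
    by rewrite a0// !mulr0 invr0 !mulr0 mul0r mulr0.
  by move=> l _; rewrite oppr0 mul0r expR0 expr0.
have w0 : 0 < rho * tau by rewrite mulr_gt0.
have wn : rho * tau != 0 by rewrite gt_eqF.
have dn : d != 0 by rewrite gt_eqF.
have -> : - rho * tau = - (rho * tau) by rewrite mulNr.
have -> : expR 1 * rho * tau / d = expR 1 * (rho * tau / d) by rewrite !mulrA.
have H := @exp_decay_le _ n a x rho tau d (ln (d / (rho * tau))) rho0.
move: (rho * tau) w0 wn wd H => w w0 wn wd H.
have th0 : 0 <= ln (d / w) by rewrite ln_ge0// ler_pdivlMr// mul1r; lra.
apply: le_trans (H (ltW tau0) th0 a1 x4 a0) _.
rewrite expRN lnK ?posrE ?divr_gt0// invf_div.
have p0 : 0 < expR 1 * (w / d) by rewrite mulr_gt0 ?expR_gt0 ?divr_gt0.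
have -> : (expR 1 * (w / d)) `^ d = expR (d * (1 - ln (d / w))).
  rewrite /powR gt_eqF// lnM ?posrE ?expR_gt0 ?divr_gt0// expRK.
  by rewrite -[d / w]invf_div lnV ?posrE ?divr_gt0// opprK.
have -> : 2 * w * ((d / w + w / d) / 2 - 1) - ln (d / w) * d =
    (w ^+ 2 / d - w) + (- w + d * (1 - ln (d / w))) by field; rewrite wn dn.
set G := d * _; have -> : 10 * (expR (- w) / w * expR G) = 10 / w * expR (- w + G).
  by rewrite expRD; ring.
rewrite expRD mulrA; apply: ler_wpM2r; first exact: expR_ge0.
have q : w ^+ 2 / d - w <= - (w / 2).
  have : w ^+ 2 / d <= w / 2 by rewrite ler_pdivrMr//; nra.
  lra.
(* What remains is w <= 5 exp(w / 2), a consequence of 1 + w / 2 <= exp(w / 2). *)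
apply: (@le_trans _ _ (2 * expR (- (w / 2)))); first by rewrite ler_pM2l// ler_expR.
rewrite expRN ler_pdivrMr ?expR_gt0// mulrAC ler_pdivlMr//.
have := expR_ge1Dx (w / 2); lra.
Qed.

(** * Diagonalizable matrices over a field *)

Section Diagonalization.
Context {F : fieldType} {n : nat}.
Implicit Types (P : 'M[F]_n) (d : 'rV[F]_n).

Definition conj_diag P d : 'M[F]_n := invmx P *m diag_mx d *m P.

Lemma conj_diag_entry P d k t :
  conj_diag P d k t = \sum_l invmx P k l * P l t * d 0 l.
Proof.
rewrite /conj_diag mul_mx_diag mxE; apply: eq_bigr => l _.
by rewrite mxE mulrAC.
Qed.

(* Two diagonalizations [P^-1 D P = P'^-1 D' P'] are intertwined by [Q = P' P^-1]:
   from [D' Q = Q D] it follows that [phi(D') Q = Q phi(D)]. *)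
Lemma conj_diag_map P P' d d' (phi : F -> F) :
  P \in unitmx -> P' \in unitmx -> conj_diag P d = conj_diag P' d' ->
  conj_diag P (map_mx phi d) = conj_diag P' (map_mx phi d').
Proof.
rewrite /conj_diag => Pu Pu' E.
have [Q QP PQ] : exists2 Q, Q *m P = P' & invmx P' *m Q = invmx P.
  by exists (P' *m invmx P); rewrite ?mulmxKV// mulmxA mulVmx// mul1mx.
have dQ : diag_mx d' *m Q = Q *m diag_mx d.
  have -> : Q = P' *m invmx P by rewrite -QP mulmxK.
  move/(congr1 (fun A => P' *m A *m invmx P)): E => /=.
  by rewrite !mulmxA mulmxK// mulmxV// mul1mx => ->.
have fdQ : diag_mx (map_mx phi d') *m Q = Q *m diag_mx (map_mx phi d).
  apply/matrixP => i j; move/matrixP/(_ i j): dQ.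
  rewrite !mul_diag_mx !mul_mx_diag !mxE [RHS]mulrC => /eqP.
  rewrite -subr_eq0 -mulrBl mulf_eq0 => /orP[|/eqP->]; last by rewrite mulr0 mul0r.
  by rewrite subr_eq0 => /eqP ->; rewrite mulrC.
by rewrite -[X in _ = _ *m X]QP !mulmxA -(mulmxA (invmx P')) fdQ mulmxA PQ.
Qed.

Lemma conj_diag_affine P d (a b : F) : P \in unitmx ->
  a *: conj_diag P d + b%:M = conj_diag P (\row_l (a * d 0 l + b)).
Proof.
rewrite /conj_diag => Pu; set d' := \row_l _.
have -> : diag_mx d' = a *: diag_mx d + b%:M.
  apply/matrixP => i j; rewrite !mxE.
  by case: eqP => [->|]; rewrite ?mulr1n ?mulr0n ?mulr0 ?addr0.
rewrite mulmxDr mulmxDl -scalemxAr -scalemxAl mul_mx_scalar -scalemxAl.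
by rewrite mulVmx// scalemx1.
Qed.

Lemma conj_diagM P d d' : P \in unitmx ->
  conj_diag P d *m conj_diag P d' = conj_diag P (\row_l (d 0 l * d' 0 l)).
Proof.
by move=> Pu; rewrite /conj_diag -mulmx_diag !mulmxA mulmxK.
Qed.

Lemma conj_diag1 P : P \in unitmx -> conj_diag P (const_mx 1) = 1%:M.
Proof. by move=> Pu; rewrite /conj_diag diag_const_mx mulmx1 mulVmx. Qed.

(** Row [l] of [P] is a left eigenvector, nonzero because [P] is invertible. *)
Lemma conj_diag_eigenvalue P d l : P \in unitmx -> eigenvalue (conj_diag P d) (d 0 l).
Proof.
move=> Pu; apply/eigenvalueP; exists (row l P).
  rewrite /conj_diag -row_mul !mulmxA mulmxV// mul1mx.
  by rewrite mul_diag_mx; apply/rowP => j; rewrite !mxE.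
apply/eqP => r0; move: Pu; rewrite unitmxE (expand_det_row _ l).
rewrite big1 ?unitr0// => j _.
by move/rowP/(_ j): r0; rewrite !mxE => ->; rewrite mul0r.
Qed.

Lemma eigenvalue_sub_scalar (M : 'M[F]_n) (x y : F) :
  eigenvalue M x -> eigenvalue (M - y%:M) (x - y).
Proof.
move=> /eigenvalueP[v vM v0]; apply/eigenvalueP; exists v => //.
by rewrite mulmxBr vM mul_mx_scalar scalerBl.
Qed.

End Diagonalization.

(** * Functions of a Hermitian matrix *)

Section HermitianFunctions.
Local Open Scope sesquilinear_scope.
Context {R : realType} {n : nat}.
Implicit Types (M A : 'M[R[i]]_n) (f g : R -> R).

Definition spec_eig M (l : 'I_n) : R := complex.Re (spectral_diag M 0 l).

Definition spec_coef M (k t l : 'I_n) : R[i] :=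
  invmx (spectralmx M) k l * spectralmx M l t.

Lemma herm_funE f M : herm_fun f M = conj_diag (spectralmx M)
  (map_mx (fun z => (f (complex.Re z))%:C) (spectral_diag M)).
Proof. by []. Qed.

Lemma herm_fun_entry f M k t :
  herm_fun f M k t = \sum_l spec_coef M k t l * (f (spec_eig M l))%:C.
Proof.
by rewrite herm_funE conj_diag_entry; apply: eq_bigr => l _; rewrite mxE.
Qed.

Lemma hermitian_conj_diag M : M \is hermsymmx ->
  M = conj_diag (spectralmx M) (spectral_diag M).
Proof. by move=> /hermitian_normalmx /orthomx_spectralP. Qed.

(** The unitary matrix chosen for a M + b may differ from the one chosen for M. Both diagonalize a M
    + b, and by [conj_diag_map] the result does not depend on the choice. *)
Lemma herm_fun_affine g M (a b : R) : M \is hermsymmx ->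
  herm_fun g (a%:C *: M + (b%:C)%:M) = herm_fun (fun x => g (a * x + b)) M.
Proof.
move=> /hermitian_conj_diag ME.
pose d' : 'rV[R[i]]_n := \row_l (a%:C * spectral_diag M 0 l + b%:C).
have ME' : a%:C *: M + (b%:C)%:M = conj_diag (spectralmx M) d'.
  by rewrite -conj_diag_affine ?spectral_unit// -ME.
have nA : a%:C *: M + (b%:C)%:M \is normalmx.
  apply/orthomx_spectral_subproof; exists (spectralmx M, d') => //.
  exact: spectral_unitarymx.
have E : conj_diag (spectralmx (a%:C *: M + (b%:C)%:M))
    (spectral_diag (a%:C *: M + (b%:C)%:M)) = conj_diag (spectralmx M) d'.
  by rewrite -ME'; apply/esym/orthomx_spectralP.
apply: etrans (herm_funE _ _) _; apply: etrans _ (esym (herm_funE _ _)).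
apply: etrans (conj_diag_map _ (spectral_unit _) (spectral_unit _) E) _.
apply: (congr1 (conj_diag _)); apply/rowP => l; rewrite !mxE.
by congr ((g _)%:C); case: (spectral_diag M 0 l) => x y /=; rewrite mul0r subr0.
Qed.

Lemma spec_eigE M l : M \is hermsymmx -> (spec_eig M l)%:C = spectral_diag M 0 l.
Proof.
by move=> /hermitian_spectral_diag_real/mxOverP/(_ 0 l) h; rewrite /spec_eig RRe_real.
Qed.

Lemma herm_fun_affine_id M (a b : R) : M \is hermsymmx ->
  herm_fun (fun x => a * x + b) M = a%:C *: M + (b%:C)%:M.
Proof.
move=> hM; have ME := hermitian_conj_diag hM.
have E := conj_diag_affine (spectral_diag M) a%:C b%:C (spectral_unit M).
rewrite -ME in E; rewrite E; apply: etrans (herm_funE _ _) _.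
apply: (congr1 (conj_diag _)); apply/rowP => l.
by rewrite !mxE -spec_eigE// -rmorphM -rmorphD.
Qed.

Lemma herm_funM f g M :
  herm_fun f M *m herm_fun g M = herm_fun (fun x => f x * g x) M.
Proof.
apply: etrans (conj_diagM _ _ (spectral_unit M)) _.
apply: etrans _ (esym (herm_funE _ _)); apply: (congr1 (conj_diag _)).
by apply/rowP => l; rewrite !mxE rmorphM.
Qed.

Lemma herm_fun1 M : herm_fun (fun=> 1) M = 1%:M.
Proof.
apply: etrans (herm_funE _ _) _; apply: etrans _ (conj_diag1 (spectral_unit M)).
apply: (congr1 (conj_diag _)).
by apply/rowP => l; rewrite !mxE.
Qed.

(** By the triangle inequality every middle index is too far from [i] or from [j]. *)
Lemma banded_mulmx (b1 b2 : nat) M A :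
  banded b1 M -> banded b2 A -> banded (b1 + b2) (M *m A).
Proof.
move=> hM hA i j ij; rewrite mxE big1// => l _.
have [il|il] := ltP (b1%:R : R) `|i%:R - l%:R|; first by rewrite hM// mul0r.
rewrite [A l j]hA ?mulr0//.
have : `|i%:R - j%:R| <= `|i%:R - l%:R| + `|l%:R - j%:R| :> R.
  by apply: le_trans (ler_normD _ _); rewrite addrA subrK.
by move: ij; rewrite natrD; lra.
Qed.

Lemma banded_affine (b : nat) M (x y : R[i]) :
  banded b M -> banded b (x *: M + y%:M).
Proof.
move=> hM i j ij; rewrite !mxE hM// mulr0 add0r.
case: eqP => [ijE|]; last by rewrite mulr0n.
by move: ij; rewrite ijE subrr normr0 ltNge ler0n.
Qed.

(** This is the j-th matrix power of the b-banded matrix x M + y, and each factor adds b to the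
    bandwidth. It is the source of the vanishing moments. *)
Lemma banded_herm_fun_expr (b : nat) M (x y : R) (j : nat) :
  M \is hermsymmx -> banded b M ->
  banded (j * b) (herm_fun (fun z => (x * z + y) ^+ j) M).
Proof.
move=> hM bM; elim: j => [|j IH].
  move=> i l il; rewrite (_ : (fun=> _) = fun=> 1) ?herm_fun1; last first.
    by apply/funext => z; rewrite expr0.
  rewrite mxE; case: eqP il => [->|//]; by rewrite subrr normr0 ltxx.
rewrite mulSn (_ : herm_fun _ _ =
    herm_fun (fun z => x * z + y) M *m herm_fun (fun z => (x * z + y) ^+ j) M).
  by apply: banded_mulmx IH; rewrite herm_fun_affine_id//; apply: banded_affine.
by rewrite herm_funM; congr herm_fun; apply/funext => z; rewrite exprS.
Qed.

(** With P the unitary [spectralmx M], |P_lk| |P_lt| <= (|P_lk|^2 + |P_lt|^2) / 2, and the columns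
    of P have norm 1. *)
Lemma sum_spec_coef_le1 M k t :
  \sum_l ComplexField.Normc.normc (spec_coef M k t l) <= 1.
Proof.
have Pu := spectral_unitarymx M.
have colN (j : 'I_n) : \sum_l ComplexField.Normc.normc (spectralmx M l j) ^+ 2 = 1.
  have /matrixP/(_ j j) : invmx (spectralmx M) *m spectralmx M = 1%:M.
    by rewrite mulVmx ?spectral_unit.
  rewrite invmx_unitary// !mxE eqxx => h; apply: (@complexI R).
  rewrite rmorph_sum rmorph1; apply: etrans h; apply: eq_bigr => l _.
  by rewrite !mxE rmorphXn mulrC -normCK.
apply: le_trans (_ : \sum_l (ComplexField.Normc.normc (spectralmx M l k) ^+ 2 / 2 +
   ComplexField.Normc.normc (spectralmx M l t) ^+ 2 / 2) <= _).
  apply: ler_sum => l _; rewrite /spec_coef invmx_unitary// ComplexField.Normc.normcM.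
  have -> : ComplexField.Normc.normc ((spectralmx M)^t* k l) =
      ComplexField.Normc.normc (spectralmx M l k).
    by rewrite !mxE; case: (spectralmx M l k) => x y /=; rewrite sqrrN.
  have := sqr_ge0 (ComplexField.Normc.normc (spectralmx M l k) -
    ComplexField.Normc.normc (spectralmx M l t)).
  nra.
by rewrite big_split/= -!mulr_suml !colN; lra.
Qed.

Lemma spec_eig_eigenvalue M l : M \is hermsymmx -> eigenvalue M (spec_eig M l)%:C.
Proof.
move=> hM; rewrite {1}(hermitian_conj_diag hM) spec_eigE//.
exact: conj_diag_eigenvalue (spectral_unit M).
Qed.

(** An eigenvector is here a row v with v M = x v, so the form is tested on its conjugate transpose,
    where it takes the value x |v|^2. *)
Lemma posdef_eigenvalue_gt0 M (x : R[i]) : posdef M -> eigenvalue M x -> 0 < x.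
Proof.
move=> pM /eigenvalueP[v vM v0].
have w0 : v^t* != 0.
  by apply: contra v0 => /eqP w0; rewrite -[v]trmxCK w0 trmx0 map_mx0.
have := pM _ w0; rewrite trmxCK vM -scalemxAl mxE.
have s0 : 0 <= (v *m v^t*) 0 0.
  by rewrite mxE sumr_ge0// => j _; rewrite !mxE mul_conjC_ge0.
move=> h; rewrite -(pmulr_lgt0 _ (_ : 0 < (v *m v^t*) 0 0))//.
rewrite lt_def s0 andbT; apply/eqP => s; by rewrite s mulr0 ltxx in h.
Qed.

End HermitianFunctions.

(** * Reduction of complex functionals to real ones *)

Lemma normc_ge0 (R : rcfType) (z : R[i]) : 0 <= ComplexField.Normc.normc z.
Proof. by case: z => x y; exact: sqrtr_ge0. Qed.

(* [a l] is the real part of [u * c l], with [u] the conjugate phase of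
   [\sum_l c l * (g l)%:C]. *)
Lemma real_functional (R : realType) (n : nat) (c : 'I_n -> R[i]) (g : 'I_n -> R) :
  \sum_l ComplexField.Normc.normc (c l) <= 1 ->
  exists a : 'I_n -> R, [/\ \sum_l `|a l| <= 1,
    ComplexField.Normc.normc (\sum_l c l * (g l)%:C) = \sum_l a l * g l &
    forall h : 'I_n -> R,
      `|\sum_l a l * h l| <= ComplexField.Normc.normc (\sum_l c l * (h l)%:C)].
Proof.
move=> c1.
have Re_le (z : R[i]) : `|complex.Re z| <= ComplexField.Normc.normc z.
  case: z => x y /=; rewrite -sqrtr_sqr ler_wsqrtr// lerDl sqr_ge0//.
have phase (z : R[i]) : exists2 u : R[i], ComplexField.Normc.normc u <= 1 &
    complex.Re (u * z) = ComplexField.Normc.normc z.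
  (* Zero has no phase; [u = 0] serves there, so [u] is only claimed to have modulus at most 1. *)
  have [z0|z0] := eqVneq (ComplexField.Normc.normc z) 0.
    exists 0; first by rewrite ComplexField.Normc.normc0.
    by rewrite mul0r z0.
  exists ((ComplexField.Normc.normc z)^-1%:C * z^*%C).
    rewrite ComplexField.Normc.normcM; case: z z0 => x y /= z0.
    by rewrite expr0n/= addr0 sqrtr_sqr sqrrN ger0_norm ?invr_ge0 ?sqrtr_ge0// mulVf.
  case: z z0 => x y /= z0; have := sqr_sqrtr (addr_ge0 (sqr_ge0 x) (sqr_ge0 y)).
  set N := Num.sqrt _ in z0 *; move=> NE.
  apply: (mulfI z0); rewrite -expr2 NE; field; exact: z0.
have [u u1 uz] := phase (\sum_l c l * (g l)%:C).
have ReE (h : 'I_n -> R) :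
    complex.Re (u * \sum_l c l * (h l)%:C) = \sum_l complex.Re (u * c l) * h l.
  rewrite mulr_sumr (big_morph (@complex.Re R) (id1 := 0) (op1 := +%R))//; last by case=> ? ? [].
  apply: eq_bigr => l _; rewrite mulrA; case: (u * c l) => x y /=.
  by rewrite mulr0 subr0.
exists (fun l => complex.Re (u * c l)); split.
- apply: le_trans c1; apply: ler_sum => l _; apply: le_trans (Re_le _) _.
  by rewrite ComplexField.Normc.normcM ler_piMl ?normc_ge0.
- by rewrite -ReE uz.
- move=> h; rewrite -ReE; apply: le_trans (Re_le _) _.
  by rewrite ComplexField.Normc.normcM ler_piMl ?normc_ge0.
Qed.

(** * Integration and measurability *)

(** Meant for intervals sharing an endpoint, which may be an atom of the measure; hence only an
    inequality, obtained by replacing [Y] with [Y] minus [X]. *)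
Lemma ge0_integral_setU_le (d : measure_display) (T : measurableType d)
    (R : realType) (mu : {measure set T -> \bar R}) (X Y : set T) (f : T -> \bar R) :
  measurable X -> measurable Y -> measurable_fun setT f -> (forall x, 0 <= f x)%E ->
  (\int[mu]_(x in X `|` Y) f x <= \int[mu]_(x in X) f x + \int[mu]_(x in Y) f x)%E.
Proof.
move=> mX mY mf f0; have mYX : measurable (Y `\` X) by exact: measurableD.
have -> : X `|` Y = X `|` (Y `\` X) by rewrite setDE setUIr setUv setIT.
rewrite ge0_integral_setU//; last first.
- by rewrite disj_set2E setDE setICA setICr setI0.
- exact: measurable_funTS.
apply: leeD => //; apply: ge0_subset_integral => //.
exact: measurable_funTS.
Qed.

(** The inverse is expressed through a real power of the nonnegative number x^2; at 0 both sides are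
    0. *)
Lemma measurable_inv (R : realType) : measurable_fun setT (fun x : R => x^-1).
Proof.
rewrite (_ : (fun _ => _) = fun x : R => x * (x * x) `^ (- 1)).
  apply: measurable_funM => //.
  apply: (measurableT_comp (measurable_powR (- 1))).
  exact: measurable_funM.
apply/funext => x; have [->|x0] := eqVneq x 0; first by rewrite invr0 mul0r.
by rewrite powR_inv1 -?expr2 ?sqr_ge0// expr2 invfM mulrA divff// mul1r.
Qed.

Lemma measurable_normc_sum (R : realType) (n : nat) (c : 'I_n -> R[i])
    (h : 'I_n -> R -> R) : (forall l, measurable_fun setT (h l)) ->
  measurable_fun setT
    (fun x => ComplexField.Normc.normc (\sum_l c l * (h l x)%:C)).
Proof.
move=> mh.
have ReE x : complex.Re (\sum_l c l * (h l x)%:C) = \sum_l complex.Re (c l) * h l x.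
  rewrite (big_morph (@complex.Re R) (id1 := 0) (op1 := +%R))//; last by case=> ? ? [].
  by apply: eq_bigr => l _; case: (c l) => u v /=; rewrite mulr0 subr0.
have ImE x : complex.Im (\sum_l c l * (h l x)%:C) = \sum_l complex.Im (c l) * h l x.
  rewrite (big_morph (@complex.Im R) (id1 := 0) (op1 := +%R))//; last by case=> ? ? [].
  by apply: eq_bigr => l _; case: (c l) => u v /=; rewrite mulr0 add0r.
rewrite (_ : (fun _ => _) = fun x =>
    Num.sqrt ((\sum_l complex.Re (c l) * h l x) ^+ 2 +
              (\sum_l complex.Im (c l) * h l x) ^+ 2)); last first.
  by apply/funext => x; rewrite -ReE -ImE; case: (\sum_l _).
apply: measurableT_comp; first by apply: continuous_measurable_fun; exact: sqrt_continuous.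
by apply: measurable_funD; apply: measurable_funX; apply: measurable_sum => l;
  apply: measurable_funM.
Qed.

(** * Bounds on the entries of f(M) and of the exponential *)

(** After the rotation of [real_functional] the left side is a real sum, so the representation of f
    is integrated term by term. The last clause of [real_functional] then bounds the integrand
    pointwise by the modulus of the entry. *)
Lemma herm_fun_entry_le_integral (R : realType) (n : nat) (M : 'M[R[i]]_n)
    (f alpha : R -> R) (nd : nondecreasing_on_pos alpha) (k t : 'I_n) :
  (forall l, 0 < spec_eig M l) -> laplace_stieltjes f nd ->
  ((ComplexField.Normc.normc (herm_fun f M k t))%:E <=
    \int[stieltjes_measure nd]_(tau in `[0%R, +oo[)
      (ComplexField.Normc.normc (herm_fun (fun x => expR (- tau * x)) M k t))%:E)%E.
Proof.
move=> M0 fE; rewrite herm_fun_entry.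
have [a [a1 -> ha]] := real_functional (fun l => f (spec_eig M l)) (sum_spec_coef_le1 M k t).
have mE (x : R) : measurable_fun setT (fun tau : R => expR (- x * tau)).
  by apply: measurableT_comp => //; apply: measurable_funM => //.
have iE l : (stieltjes_measure nd).-integrable `[0%R, +oo[
    (fun tau => (expR (- spec_eig M l * tau))%:E).
  apply/integrableP; split.
    apply/measurable_EFinP; apply: measurable_funTS. exact: mE.
  (* Integrability holds because the integral of this positive function is the finite number f(m_l),
     as m_l > 0. *)
  rewrite (_ : integral _ _ _ = (f (spec_eig M l))%:E) ?ltry//.
  rewrite -fE//; apply: eq_integral => tau _ /=.
  by rewrite ger0_norm// expR_ge0.
have -> : ((\sum_l a l * f (spec_eig M l))%:E =
    \int[stieltjes_measure nd]_(tau in `[0%R, +oo[)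
      (\sum_l a l * expR (- spec_eig M l * tau))%:E)%E.
  under [in RHS]eq_integral do rewrite -sumEFin.
  under [in RHS]eq_integral do under eq_bigr do rewrite EFinM.
  rewrite integral_sum//; last by move=> l; exact: integrableZl.
  by rewrite -sumEFin; apply: eq_bigr => l _; rewrite integralZl// fE// EFinM.
have mS : measurable_fun setT (fun tau : R => \sum_l a l * expR (- spec_eig M l * tau)).
  by apply: measurable_sum => l; apply: measurable_funM.
have mN : measurable_fun setT (fun tau : R =>
    ComplexField.Normc.normc (herm_fun (fun x => expR (- tau * x)) M k t)).
  under eq_fun do rewrite herm_fun_entry.
  apply: measurable_normc_sum => l; apply: measurableT_comp => //.
  by apply: measurable_funM => //; exact: measurable_funN.
apply: le_trans (lee_abs _) _; apply: le_trans (le_abse_integral _ _ _) _ => //.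
  by apply/measurable_EFinP; apply: measurable_funTS; exact: mS.
apply: ge0_le_integral => //=.
- apply/measurable_EFinP; apply: measurable_funTS.
  by apply: (measurableT_comp (@normr_measurable R setT)); exact: mS.
- by apply/measurable_EFinP; apply: measurable_funTS; exact: mN.
- move=> tau _; rewrite lee_fin herm_fun_entry.
  apply: le_trans (ha (fun l => expR (- tau * spec_eig M l))).
  rewrite le_eqVlt; apply/orP; left; apply/eqP; congr (`| _ |).
  by apply: eq_bigr => l _; rewrite !mulNr (mulrC tau).
Qed.

(** Passes from the scalar estimates to matrix entries. Moments of order j < d vanish because the
    j-th power is banded with width j beta < d beta <= |k - t|. *)
Lemma herm_fun_exp_entry_le (R : realType) (n beta : nat) (M : 'M[R[i]]_n)
    (lmin rho d tau : R) (k t : 'I_n) (B : R) :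
  M \is hermsymmx -> banded beta M -> (0 < beta)%N ->
  d * beta%:R <= `|k%:R - t%:R| ->
  (forall a : 'I_n -> R, \sum_l `|a l| <= 1 ->
    (forall j : nat, j%:R < d ->
      \sum_l a l * (1 - (spec_eig M l - lmin) / (2 * rho)) ^+ j = 0) ->
    \sum_l a l * expR (- tau * (spec_eig M l - lmin)) <= B) ->
  ComplexField.Normc.normc
    (herm_fun (fun x => expR (- tau * (x - lmin))) M k t) <= B.
Proof.
move=> hM bM b0 dist H; rewrite herm_fun_entry.
have [a [a1 -> ha]] := real_functional
  (fun l => expR (- tau * (spec_eig M l - lmin))) (sum_spec_coef_le1 M k t).
apply: H => // j jd; apply/eqP; rewrite -normr_le0.
(* The last clause of [real_functional] carries the vanishing from the complex coefficients over to
   [a]. *)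
apply: le_trans (ha (fun l => (1 - (spec_eig M l - lmin) / (2 * rho)) ^+ j)) _.
have -> : \sum_l spec_coef M k t l * ((1 - (spec_eig M l - lmin) / (2 * rho)) ^+ j)%:C =
    herm_fun (fun x => (- (2 * rho)^-1 * x + (1 + lmin / (2 * rho))) ^+ j) M k t.
  rewrite herm_fun_entry; apply: eq_bigr => l _.
  by congr (_ * (_ ^+ _)%:C); ring.
rewrite (banded_herm_fun_expr _ _ hM bM) ?ComplexField.Normc.normc0//.
by apply: lt_le_trans dist; rewrite natrM ltr_pM2r// ltr0n.
Qed.

Unset Implicit Arguments.
Set Strict Implicit.

Theorem theorem4p4 (R : realType) (n beta : nat) (M : 'M[R[i]]_n)
    (lmin rho : R) (f alpha : R -> R)
    (beta_ge1 : (1 <= beta)%N)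
    (M_herm : M \is hermsymmx)
    (M_banded : banded beta M)
    (M_posdef : posdef M)
    (lminP : smallest_eigenvalue M lmin)
    (rho_gt0 : 0 < rho)
    (Mhat_spec : spectrum_in (M - (lmin%:C)%:M) 0 (4 * rho))
    (f_scm : strictly_completely_monotonic f)
    (alpha_nd : nondecreasing_on_pos alpha)
    (f_alpha : laplace_stieltjes f alpha_nd)
    (k t : 'I_n)
    (kt_far : 2 <= `|k%:R - t%:R| / beta%:R :> R) :
  let Mhat : 'M[R[i]]_n := M - (lmin%:C)%:M in
  let dalpha := stieltjes_measure alpha_nd in
  let b : R := beta%:R in
  let dist : R := `|k%:R - t%:R| in
  let exp_entry (tau : R) : R :=
    ComplexField.Normc.normc (herm_fun (fun x => expR (- tau * x)) Mhat k t) in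
  let I : \bar R :=
    (10%:E * \int[dalpha]_(tau in `[0%R, (dist / (2 * rho * b))%R])
      (expR (- lmin * tau) * (expR (- rho * tau) / (rho * tau))
        * (expR 1 * rho * tau / (dist / b)) `^ (dist / b))%:E)%E in
  let II : \bar R :=
    (10%:E * \int[dalpha]_(tau in
        `[(dist / (2 * rho * b))%R, (dist ^+ 2 / (4 * rho * b ^+ 2))%R])
      (expR (- lmin * tau)
        * expR (- ((dist / b) ^+ 2 / (5 * rho * tau))))%:E)%E in
  let III : \bar R :=
    (\int[dalpha]_(tau in `[(dist ^+ 2 / (4 * rho * b ^+ 2))%R, +oo[)
      (expR (- lmin * tau) * exp_entry tau)%:E)%E in
  let total : \bar R :=
    (\int[dalpha]_(tau in `[0%R, +oo[)
      (expR (- lmin * tau) * exp_entry tau)%:E)%E in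
  ((ComplexField.Normc.normc (herm_fun f M k t))%:E <= total)%E /\
  (total <= I + II + III)%E.
Proof.
move=> Mhat dalpha b dist exp_entry I1 I2 I3 total.
have b0 : 0 < b by rewrite ltr0n.
have lmin0 : 0 < lmin.
  by have := posdef_eigenvalue_gt0 M_posdef (proj1 lminP); rewrite ltcR.
have eigM l := spec_eig_eigenvalue l M_herm.
have eig_ge l : lmin <= spec_eig M l by have := proj2 lminP _ (eigM l); rewrite lecR.
have eig_itv l : 0 <= spec_eig M l - lmin <= 4 * rho.
  have := Mhat_spec _ (eigenvalue_sub_scalar lmin%:C (eigM l)).
  by rewrite -rmorphB !lecR.
(* Functions of [Mhat] become functions of [M], so that a single spectral decomposition serves
   throughout. *)
have entryE tau : exp_entry tau = ComplexField.Normc.normc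
    (herm_fun (fun x => expR (- tau * (x - lmin))) M k t).
  have E : herm_fun (fun x => expR (- tau * x)) Mhat =
      herm_fun (fun x => expR (- tau * (x - lmin))) M.
    have -> : Mhat = 1%:C *: M + ((- lmin)%:C)%:M by rewrite scale1r rmorphN raddfN.
    apply: etrans (herm_fun_affine _ 1 (- lmin) M_herm) _.
    by apply: (congr1 (fun h => herm_fun h M)); apply/funext => x; rewrite mul1r.
  by rewrite /exp_entry E.
have entry0 tau : 0 <= exp_entry tau by exact: normc_ge0.
(* The positive factor exp(-lmin tau) moves inside the modulus and undoes the shift by [lmin]. *)
have shiftE tau : expR (- lmin * tau) * exp_entry tau =
    ComplexField.Normc.normc (herm_fun (fun x => expR (- tau * x)) M k t).
  rewrite entryE !herm_fun_entry -[X in X * _]ger0_norm ?expR_ge0//.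
  have -> : `|expR (- lmin * tau)| = ComplexField.Normc.normc (expR (- lmin * tau))%:C.
    by rewrite /= expr0n/= addr0 sqrtr_sqr.
  rewrite -ComplexField.Normc.normcM mulr_sumr; congr ComplexField.Normc.normc.
  apply: eq_bigr => l _; rewrite mulrCA -rmorphM -expRD.
  by congr (_ * (expR _)%:C); ring.
split.
  rewrite /total; under eq_integral do rewrite shiftE.
  by apply: herm_fun_entry_le_integral => // l; exact: lt_le_trans (eig_ge l).
have mexp (x : R) : measurable_fun setT (fun tau : R => expR (x * tau)).
  by apply: measurableT_comp => //; apply: measurable_funM.
have mg : measurable_fun setT (fun tau : R => expR (- lmin * tau) * exp_entry tau).
  under eq_fun do rewrite shiftE herm_fun_entry.
  apply: measurable_normc_sum => l; apply: measurableT_comp => //.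
  by apply: measurable_funM => //; exact: measurable_funN.
have g0 tau : 0 <= expR (- lmin * tau) * exp_entry tau by rewrite mulr_ge0 ?expR_ge0.
have d2 : 2 <= dist / b by [].
have d0 : 0 < dist / b by exact: lt_le_trans d2.
have dist0 : 0 < dist by rewrite -(pmulr_lgt0 _ (_ : 0 < b^-1)) ?invr_gt0.
set A := dist / (2 * rho * b); set B := dist ^+ 2 / (4 * rho * b ^+ 2).
have A0 : 0 < A by rewrite divr_gt0// !mulr_gt0.
have AE : A = dist / b / (2 * rho) by rewrite /A; field; rewrite !gt_eqF.
(* With d = |k - t| / beta, B = A d / 2, so d >= 2 orders the endpoints. *)
have AB : A <= B.
  have -> : B = A * (dist / b / 2) by rewrite /B /A; field; rewrite !gt_eqF.
  by rewrite ler_peMr ?(ltW A0)//; lra.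
have cover : `[0%R, +oo[%classic = `[0%R, A] `|` (`[A, B] `|` `[B, +oo[) :> set R.
  apply/seteqP; split => [x|x]; rewrite /= !in_itv/= ?andbT.
    move=> x0; have [xA|Ax] := leP x A; first by left; rewrite x0.
    by right; have [xB|Bx] := leP x B; [left; rewrite (ltW Ax)|right; exact: ltW].
  case=> [/andP[]//|[/andP[Ax _]|Bx]]; first exact: le_trans (ltW A0) Ax.
  exact: le_trans (ltW A0) (le_trans AB Bx).
have key tau C : (forall a : 'I_n -> R, \sum_l `|a l| <= 1 ->
    (forall j : nat, j%:R < dist / b ->
      \sum_l a l * (1 - (spec_eig M l - lmin) / (2 * rho)) ^+ j = 0) ->
    \sum_l a l * expR (- tau * (spec_eig M l - lmin)) <= C) -> exp_entry tau <= C.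
  move=> H; rewrite entryE; apply: (herm_fun_exp_entry_le M_herm M_banded beta_ge1 _ H).
  by rewrite divfK ?gt_eqF.
rewrite /total cover.
have mgE : measurable_fun setT (fun tau : R => (expR (- lmin * tau) * exp_entry tau)%:E).
  exact/measurable_EFinP.
apply: le_trans (ge0_integral_setU_le _ _ _ _ _) _ => //.
  exact: measurableU.
rewrite -(addeA I1); apply: leeD; last first.
  apply: le_trans (ge0_integral_setU_le _ _ _ _ _) _ => //.
  apply: leeD => //; rewrite /I2.
  have mII : measurable_fun setT (fun tau : R =>
      expR (- lmin * tau) * expR (- ((dist / b) ^+ 2 / (5 * rho * tau)))).
    apply: measurable_funM => //; apply: measurableT_comp => //.
    apply: measurable_funN; apply: measurable_funM => //.
    by apply: (measurableT_comp (@measurable_inv R)); apply: measurable_funM.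
  rewrite -ge0_integralZl//.
  - apply: ge0_le_integral => //.
    + by move=> x _; rewrite lee_fin.
    + exact: measurable_funTS.
    + apply/measurable_EFinP; apply: measurable_funTS; apply: measurable_funM => //; exact: mII.
    + move=> tau /=; rewrite in_itv/= => /andP[Atau _]; rewrite -EFinM lee_fin mulrCA.
      rewrite ler_pM2l ?expR_gt0//; apply: key => a a1 a0.
      apply: exp_decay_gaussian => //.
      (* Since A = d / (2 rho), the condition A <= tau is exactly d <= 2 rho tau, the range of the
         Gaussian bound. *)
      move: Atau; rewrite AE ler_pdivrMr ?mulr_gt0//; lra.
  - by apply/measurable_EFinP; apply: measurable_funTS; exact: mII.
rewrite /I1.
have mI : measurable_fun setT (fun tau : R =>
    expR (- lmin * tau) * (expR (- rho * tau) / (rho * tau))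
        * (expR 1 * rho * tau / (dist / b)) `^ (dist / b)).
  apply: measurable_funM.
    apply: measurable_funM => //; apply: measurable_funM => //.
    by apply: (measurableT_comp (@measurable_inv R)); apply: measurable_funM.
  apply: (measurableT_comp (measurable_powR _)).
  by apply: measurable_funM => //; apply: measurable_funM.
rewrite -ge0_integralZl//.
- apply: ge0_le_integral => //.
  + by move=> x _; rewrite lee_fin.
  + exact: measurable_funTS.
  + apply/measurable_EFinP; apply: measurable_funTS; apply: measurable_funM => //; exact: mI.
  + move=> tau /=; rewrite in_itv/= => /andP[tau0 tauA]; rewrite -EFinM lee_fin -mulrA mulrCA.
    rewrite ler_pM2l ?expR_gt0//; apply: key => a a1 a0.
    apply: exp_decay_poisson => //.
    move: tauA; rewrite AE ler_pdivlMr ?mulr_gt0//; lra.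
- by apply/measurable_EFinP; apply: measurable_funTS; exact: mI.
- move=> x /=; rewrite in_itv/= => /andP[x0 _]; rewrite lee_fin !mulr_ge0 ?expR_ge0 ?powR_ge0//.
  by rewrite invr_ge0 mulr_ge0// ltW.
Qed.
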